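(* Let $\theta,\alpha\in(0,1)$ with $\theta$ irrational, and let $f(x)\in\mathbb Z[x]$ be a non-constant polynomial. Then the integer sequence $\boldsymbol u=\langle u_m\rangle_{m=0}^\infty$ given by $u_m:=f(\lfloor m\theta+\alpha\rfloor)$ satisfies Condition ( * ).
   Context: Condition ( * ): an integer sequence $\boldsymbol u=\langle u_m\rangle_{m\ge0}$ satisfies Condition ( * ) if there exist an integer $\sigma\ge 0$, integers $b_0,\ldots,b_\sigma$, and an unbounded sequence of positive integers $\langle r_n\rangle_{n\ge 0}$ such that, defining for each $n\in\mathbb N$ the sequence $w_{n,m}:=\sum_{i=0}^\sigma b_i u_{m+ir_n}$ ($m\ge 0$), the following hold: (1) Expanding gaps: for every $n$, the set $\Delta_n:=\{m\in\mathbb N: w_{n,m}\neq 0\}$ is infinite, and there is a constant $c>0$ (independent of $n$) such that the minimum distance $\mu_n$ between any two distinct elements of $\Delta_n$ satisfies $\mu_n\ge c\, r_n$ for all $n$. (2) Polynomial variation: there exist constants $c_0\ge 0$ and $C'>0$ (independent of $n,m,m'$) such that for all $n\in\mathbb N$ and all $m<m'$ in $\Delta_n$, $|w_{n,m'}|\le C'\big((m'-m)^{c_0}+|w_{n,m}|\big)$. *)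

(* Defs.v *)
From HB Require Import structures.
From mathcomp Require Import all_boot all_order all_algebra.
From mathcomp Require Import all_classical all_reals all_analysis.
Set Implicit Arguments. Unset Strict Implicit. Unset Printing Implicit Defensive.
Import Order.TTheory GRing.Theory Num.Theory.
Local Open Scope ring_scope.
Local Open Scope classical_set_scope.

Definition wseq (u : nat -> int) (sigma : nat) (b : 'I_sigma.+1 -> int)
  (r : nat -> nat) (n m : nat) : int :=
  \sum_(i < sigma.+1) b i * u (m + i * r n)%N.

Definition Delta (u : nat -> int) (sigma : nat) (b : 'I_sigma.+1 -> int)
  (r : nat -> nat) (n : nat) : set nat :=
  [set m | wseq u b r n m != 0].

Definition condition_star (R : realType) (u : nat -> int) : Prop :=
  exists (sigma : nat) (b : 'I_sigma.+1 -> int) (r : nat -> nat),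
    (forall n, (0 < r n)%N) /\
    (forall M : nat, exists n, (M < r n)%N) /\
    (forall n, ~ finite_set (Delta u b r n)) /\
    (exists c : R, 0 < c /\
       forall n m m', m \in Delta u b r n -> m' \in Delta u b r n -> m <> m' ->
         c * (r n)%:R <= `| (m%:R : R) - m'%:R |) /\
    (exists (c0 C' : R), 0 <= c0 /\ 0 < C' /\
       forall n m m', m \in Delta u b r n -> m' \in Delta u b r n -> (m < m')%N ->
         ((`|wseq u b r n m'| : int)%:~R : R) <=
           C' * ((((m' - m)%N)%:R : R) `^ c0 + ((`|wseq u b r n m| : int)%:~R : R))).

(* Main.v *)
(**
Let s = deg f + 1 and b_i = (-1)^i C(s, i), so that sum_i b_i q(i) = 0 for every
polynomial q of degree less than s.  Given r, let p be an integer close to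
r theta, put eps = r theta - p and x = m theta + alpha; then
floor((m + i r) theta + alpha) = i p + floor(x + i eps).  If
s |eps| < 1 then w_m := sum_i b_i u_(m + i r) vanishes unless the progression
x, x + eps, ..., x + s eps jumps over an integer z, and then
w_m = sum_(i in J) b_i g(t + i p), where t = z - 1, g(y) = f(y + 1) - f(y), and J
is a nonempty proper initial or final segment of {0, ..., s}; the sum of the b_i
over such a J is nonzero.

Gaps.  Two jumps at distance k force the distance from k theta to the integers to be
less than s |eps|.  Take r to be the least k > 0 for which
k (k theta - p)^2 is below a small threshold for some p: every smaller k then
satisfies k (k theta - q)^2 > r eps^2 for all q, hence s^2 k > r whenever
|k theta - q| < s |eps|.

Variation.  If t is at least a large multiple of r, then w_m is comparable to t^D with
D = deg g.  Otherwise t = O(r) = O(m' - m), and the term (m' - m)^D suffices.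

Infinitude.  Without late jumps floor(x + i eps) would be constant in i, although
i eps is unbounded.
*)

Require Import Defs.
From HB Require Import structures.
From mathcomp Require Import all_boot all_order all_algebra.
From mathcomp Require Import all_classical all_reals all_analysis.
From mathcomp Require Import ring lra zify.
Import Order.TTheory GRing.Theory Num.Theory.
Local Open Scope ring_scope.

(** * Alternating binomial sums *)

Definition altbin (n i : nat) : int := (-1) ^+ i * 'C(n, i)%:R.

(** Pascal's rule and a summation by parts trade one order of the alternating sum for one difference
    of [F]. Vanishing on polynomials and nonvanishing on step functions both reduce to this. *)
Lemma altbin_sum_diff (n : nat) (F : nat -> int) :
  \sum_(i < n.+2) altbin n.+1 i * F i =
  \sum_(i < n.+1) altbin n i * (F i - F i.+1).
Proof.
rewrite big_ord_recl /= /altbin bin0 expr0 !mul1r.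
have -> : \sum_(i < n.+1) (-1) ^+ bump 0 i * ('C(n.+1, bump 0 i))%:R * F (bump 0 i)
  = \sum_(i < n.+1) (-1) ^+ i.+1 * 'C(n, i.+1)%:R * F i.+1
    - \sum_(i < n.+1) (-1) ^+ i * 'C(n, i)%:R * F i.+1.
  rewrite -sumrB; apply: eq_bigr => i _.
  by rewrite /bump /= add1n binS natrD exprS; ring.
rewrite big_ord_recr /= (@bin_small n n.+1) // mulr0 mul0r addr0.
under [RHS]eq_bigr => i _ do rewrite mulrBr.
by rewrite [RHS]sumrB [in RHS]big_ord_recl /= bin0 expr0 !mul1r addrA.
Qed.

(** [X + p] is monic of degree one, so composing with it keeps size and leading coefficient, and the
    top coefficients cancel. *)
Lemma size_poly_shift_sub (f : {poly int}) (p : int) (n : nat) :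
  (size f <= n.+1)%N -> (size (f - (f \Po ('X + p%:P)))%R <= n)%N.
Proof.
move=> sf; have sX : size ('X + p%:P) = 2%N.
  by rewrite size_polyDl size_polyX // size_polyC; case: (p != 0).
have lX : lead_coef ('X + p%:P) = 1 by apply/eqP; rewrite -monicE monicXaddC.
have sfc : size (f \Po ('X + p%:P)) = size f by rewrite size_comp_poly2.
apply/leq_sizeP => j; rewrite leq_eqVlt => /orP[/eqP <-|nj]; last first.
  by rewrite coefB !nth_default ?subrr // ?sfc (leq_trans sf).
rewrite coefB; move: sf; rewrite leq_eqVlt => /orP[/eqP sf|sf]; last first.
  by rewrite !nth_default ?subrr // ?sfc.
have := @lead_coef_comp _ f ('X + p%:P); rewrite sX lX expr1n mulr1 => /(_ isT).
by rewrite /lead_coef sfc sf /= => ->; rewrite subrr.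
Qed.

Lemma altbin_sum_poly (n : nat) (f : {poly int}) (t p : int) :
  (size f <= n)%N -> \sum_(i < n.+1) altbin n i * f.[t + i%:R * p] = 0.
Proof.
elim: n f => [|n IHn] f sf.
  by move: sf; rewrite leqn0 size_poly_eq0 => /eqP->; rewrite big1 // => i _; rewrite horner0 mulr0.
rewrite (altbin_sum_diff _ (fun i => f.[t + i%:R * p])).
rewrite -[RHS](IHn (f - (f \Po ('X + p%:P)))); last exact: size_poly_shift_sub.
apply: eq_bigr => i _; congr (_ * _); rewrite !hornerE horner_comp !hornerE.
by congr (_ - f.[_]); rewrite -natr1; ring.
Qed.

Lemma altbin_neq0 (n i : nat) : (i <= n)%N -> altbin n i != 0.
Proof. by move=> le_in; rewrite mulf_neq0 ?signr_eq0 // pnatr_eq0 -lt0n bin_gt0. Qed.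

(** The difference of a step function lives at the single index just before the step, so the sum
    collapses to one signed binomial coefficient. [s] selects a final segment ([false]) or an
    initial one ([true]). *)
Lemma altbin_sum_step (n j : nat) (s : bool) : (0 < j <= n)%N ->
  \sum_(i < n.+1) altbin n i * ((s (+) (j <= i)%N) : nat)%:R != 0.
Proof.
case: n j => [|n] [|j] //= jn.
rewrite (altbin_sum_diff _ (fun i => ((s (+) (j < i)%N) : nat)%:R)).
rewrite (bigD1 (Ordinal (jn : (j < n.+1)%N))) //= big1 => [|i ij].
  rewrite addr0 mulf_neq0 ?altbin_neq0 // ltnn ltnSn.
  by case: s.
have ji : i != j :> nat by apply: contraNneq ij => ij; apply/eqP/val_inj.
have -> : (j < i.+1)%N = (j < i)%N; last by rewrite subrr mulr0.
by rewrite ltnS leq_eqVlt eq_sym (negbTE ji).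
Qed.

(** * Growth of polynomial values *)

Lemma horner_upper (g : {poly int}) : exists2 A : int, 0 <= A &
  forall y N : int, 1 <= N -> `|y| <= N -> `|g.[y]| <= A * N ^+ (size g).-1.
Proof.
elim/poly_ind: g => [|h c [A A0 IH]].
  by exists 0 => // y N _ _; rewrite horner0 normr0 mul0r.
exists (A + `|c|) => [|y N N1 yN]; first by rewrite addr_ge0.
rewrite size_MXaddC !hornerE; have [->|h0] /= := eqVneq h 0.
  rewrite horner0 mul0r add0r.
  by case: (eqVneq c 0) => [->|c0] /=; rewrite ?expr0 ?size_polyC mulr1 lerDr.
have := IH y N N1 yN; set s := (size h).-1 => hy.
have -> : size h = s.+1 by rewrite prednK // lt0n size_poly_eq0.
have N0 : 0 <= N by apply: le_trans N1.
apply: (le_trans (ler_normD _ _)); rewrite mulrDl lerD //.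
  by rewrite normrM exprSr mulrA ler_pM.
by rewrite ler_peMr // exprn_ege1.
Qed.

(** On [[t, t + S * r]] the leading term has relative error O(r/t), uniformly in [r]. Multiplying
    through by [t] keeps the estimate in the integers. *)
Lemma horner_lead (g : {poly int}) (S : int) : 0 <= S -> exists2 C : int, 0 <= C &
  forall t y r : int, 1 <= r -> r <= t -> 0 <= y <= S * r ->
  `|g.[t + y] - lead_coef g * t ^+ (size g).-1| * t <= C * r * t ^+ (size g).-1.
Proof.
move=> S0; elim/poly_ind: g => [|h c [C C0 IH]].
  by exists 0 => // t y r _ _ _; rewrite !(horner0, lead_coef0, mul0r, subr0, normr0).
have [->|h0] := eqVneq h 0.
  exists 0 => // t y r _ _ _; rewrite mul0r add0r lead_coefC size_polyC hornerC.
  by case: (c != 0) => /=; rewrite expr0 ?mulr1 subrr normr0 !mul0r.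
(* The summands pay for the error of [h] multiplied by [t + y <= (1 + S) * t], for the displacement
   [y] times the leading term of [h], and for [c]. *)
exists ((1 + S) * C + S * `|lead_coef h| + `|c|) => [|t y r r1 rt /andP[y0 yS]].
  by rewrite !addr_ge0 ?mulr_ge0 ?addr_ge0.
have -> : lead_coef (h * 'X + c%:P) = lead_coef h.
  rewrite lead_coefDl ?lead_coefMX // size_mulX // size_polyC.
  by case: (c != 0) => //=; rewrite ltnS lt0n size_poly_eq0.
rewrite size_MXaddC (negbTE h0) /= !hornerE.
have := IH t y r r1 rt; rewrite y0 yS => /(_ isT).
have -> : size h = (size h).-1.+1 by rewrite prednK // lt0n size_poly_eq0.
move: (size h).-1 (lead_coef h) => D l /= H.
have t1 : 1 <= t := le_trans r1 rt.
have -> : h.[t + y] * (t + y) + c - l * t ^+ D.+1 =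
  (t + y) * (h.[t + y] - l * t ^+ D) + y * l * t ^+ D + c by rewrite exprS; ring.
move: H; set e := h.[t + y] - _ => H.
have tD : 1 <= t ^+ D by apply: exprn_ege1.
apply: (@le_trans _ _ (((t + y) * `|e| + y * `|l| * t ^+ D + `|c|) * t)).
  rewrite ler_wpM2r //; first lia.
  apply: (le_trans (ler_normD _ _)); rewrite lerD2r.
  apply: (le_trans (ler_normD _ _)); rewrite !normrM (ger0_norm y0).
  by rewrite (@ger0_norm _ (t + y)) ?(@ger0_norm _ (t ^+ D)) ?exprn_ge0 //; lia.
have ty : t + y <= (1 + S) * t by nia.
have e1 : (t + y) * `|e| * t <= (1 + S) * t * (C * r * t ^+ D).
  by rewrite -mulrA; apply: ler_pM => //; [lia | rewrite mulr_ge0 //; lia].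
have e2 : y * `|l| * t ^+ D * t <= S * r * (`|l| * t ^+ D * t).
  by rewrite -2!(mulrA y) ler_wpM2r ?mulr_ge0 //; lia.
have e3 : `|c| * t <= `|c| * (r * (t ^+ D * t)).
  rewrite ler_wpM2l //.
  by rewrite mulrA ler_peMl ?mulr_ege1 //; lia.
rewrite (mulrDl _ `|c|) (mulrDl ((t + y) * `|e|)) exprS.
apply: (le_trans (lerD (lerD e1 e2) e3)).
by rewrite le_eqVlt; apply/orP; left; apply/eqP; ring.
Qed.

(** A polynomial invariant under the unit shift equals [f.[0]] at every natural number, which gives
    [f - f.[0]] too many roots. *)
Lemma poly_shift1_neq0 (f : {poly int}) : (1 < size f)%N -> (f \Po ('X + 1)) - f != 0.
Proof.
move=> sf; apply/negP => /eqP g0.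
have fn (n : nat) : f.[n%:R] = f.[0].
  elim: n => [|n <-] //; apply/eqP; rewrite -subr_eq0 -natr1.
  have -> : f.[n%:R + 1] - f.[n%:R] = ((f \Po ('X + 1)) - f).[n%:R].
    by rewrite !hornerE horner_comp !hornerE.
  by rewrite g0 horner0.
have := @max_poly_roots _ (f - f.[0]%:P) [seq (n%:R : int) | n <- iota 0 (size f)].
rewrite size_map size_iota.
have sfc : size (f - f.[0]%:P) = size f.
  by rewrite size_polyDl // size_polyN size_polyC (leq_trans _ sf) //; case: (_ != 0).
rewrite sfc ltnn -size_poly_eq0 sfc => H; suff: false by [].
apply: H; first by rewrite -lt0n ltnW.
  by apply/allP => x /mapP[n _ ->]; rewrite rootE !hornerE fn subrr.
by rewrite map_inj_uniq ?iota_uniq // => a b /eqP; rewrite eqr_nat => /eqP.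
Qed.

Lemma exprD_le (a b : int) (D : nat) : 0 <= a -> 0 <= b ->
  (a + b) ^+ D <= (2 * a) ^+ D + (2 * b) ^+ D.
Proof.
move=> a0 b0; have [ab|/ltW ba] := leP a b.
  rewrite -[leLHS]add0r lerD ?exprn_ge0 ?mulr_ge0 // lerXn2r ?nnegrE //; lia.
rewrite -[leLHS]addr0 lerD ?exprn_ge0 ?mulr_ge0 // lerXn2r ?nnegrE //; lia.
Qed.

(** Size control of a jump sum from both sides. The constants depend on [f] alone, as the uniformity
    in n of Condition (2) demands. *)
Lemma jump_sum_estimate (f : {poly int}) : (1 < size f)%N ->
  exists (D : nat) (A K : int), [/\ 1 <= A, 2 <= K &
  forall (t p r : int) (c : nat -> bool), 1 <= r -> 0 <= p <= r ->
  let w := \sum_(i < (size f).+1) altbin (size f) i * f.[t + i%:R * p + (c i : nat)%:R] in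
  (forall N, r <= N -> `|t| <= N -> `|w| <= A * N ^+ D) /\
  (\sum_(i < (size f).+1) altbin (size f) i * (c i : nat)%:R != 0 -> K * r <= t ->
    t ^+ D <= 2 * `|w|)].
Proof.
move=> sf; set s := size f; set g := (f \Po ('X + 1)) - f.
have g0 : g != 0 := poly_shift1_neq0 f sf.
have [A A0 hA] := horner_upper g.
have [C C0 hC] := horner_lead g s%:R (ler0n _ _).
pose B := \sum_(i < s.+1) `|altbin s i|.
have B0 : 0 <= B by apply: sumr_ge0.
(* The points [t + i * p] have modulus at most [(1 + s) * N], whence the first constant. The second
   makes the error around the leading term at most half of [t ^ D]. *)
exists (size g).-1, (B * A * (1 + s%:R) ^+ (size g).-1 + 1), (2 * B * C + 2); split.
- by rewrite lerDr !mulr_ge0 // exprn_ge0 // addr_ge0.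
- by rewrite lerDr !mulr_ge0.
move=> t p r c r1 /andP[p0 pr] w.
(* The alternating sum kills [f.[t + i * p]], and a unit increment of the argument adds exactly
   [g]. *)
have wE : w = \sum_(i < s.+1) altbin s i * (c i : nat)%:R * g.[t + i%:R * p].
  apply: (@etrans _ _ (w - \sum_(i < s.+1) altbin s i * f.[t + i%:R * p])).
    by rewrite altbin_sum_poly // subr0.
  rewrite /w -sumrB; apply: eq_bigr => i _; rewrite -mulrBr -mulrA; congr (_ * _).
  rewrite hornerD hornerN horner_comp !hornerE.
  by case: (c i); rewrite /= ?mul1r // !mul0r addr0 subrr.
have isr (i : 'I_s.+1) : 0 <= i%:R * p <= s%:R * r.
  by rewrite mulr_ge0 //= ler_pM // ler_nat -ltnS.
have cle (i : nat) : `|altbin s i * (c i : nat)%:R| <= `|altbin s i|.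
  by case: (c i); rewrite ?mulr1 ?mulr0 ?normr0.
split.
- move=> N rN tN; rewrite wE.
  apply: (le_trans (ler_norm_sum _ _ _)).
  apply: (@le_trans _ _ (B * (A * ((1 + s%:R) * N) ^+ (size g).-1))); last first.
    rewrite exprMn mulrDl mul1r !mulrA lerDl exprn_ge0 //; lia.
  rewrite mulr_suml; apply: ler_sum => i _; rewrite normrM.
  apply: ler_pM => //; apply: hA; first nia.
  have /andP[i0 i1] := isr i.
  have : s%:R * r <= s%:R * N by rewrite ler_wpM2l.
  have := ler_normD t (i%:R * p); rewrite (ger0_norm i0) mulrDl mul1r; lia.
- set b := \sum_(i < s.+1) _; move=> b0 Kt.
  have rt : r <= t by nia.
  have t0 : 0 < t by lia.
  have wt : `|w - b * (lead_coef g * t ^+ (size g).-1)| * t <= B * (C * r * t ^+ (size g).-1).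
    rewrite wE mulr_suml -sumrB -[X in _ * X]gtr0_norm // -normrM mulr_suml.
    apply: (le_trans (ler_norm_sum _ _ _)).
    rewrite mulr_suml; apply: ler_sum => i _; rewrite -mulrBr -[_ * t]mulrA normrM.
    by apply: ler_pM => //; rewrite normrM (gtr0_norm t0) hC.
  (* Integrality: a nonzero integer has modulus at least 1. *)
  have bl : 1 <= `|b * lead_coef g|.
    by rewrite normrM -[1]mulr1 ler_pM // -gtz0_ge1 normr_gt0 // lead_coef_eq0.
  move: wt; rewrite mulrA; move: (b * _) bl => l l1 wt.
  set T := t ^+ _ in wt *.
  have T0 : 0 < T by rewrite exprn_gt0.
  have h1 : `|l * T| <= `|w| + `|w - l * T|.
    by have := ler_normB w (w - l * T); rewrite opprB addrCA subrr addr0.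
  rewrite normrM (gtr0_norm T0) in h1.
  have h2 : T <= `|l| * T by rewrite ler_peMl // ltW.
  rewrite -(ler_pM2r t0).
  have h3 : T * t <= `|w| * t + B * (C * r * T).
    apply: (@le_trans _ _ ((`|w| + `|w - l * T|) * t)); first by rewrite ler_pM2r //; lia.
    by rewrite mulrDl lerD2l.
  have h4 : 2 * (B * (C * r * T)) <= T * t.
    have : T * ((2 * B * C + 2) * r) <= T * t by rewrite ler_pM2l.
    have : 0 <= T * r by rewrite mulr_ge0 //; lia.
    by lia.
  lia.
Qed.

(** * Shifts that are good approximations *)

(** Pigeonhole: N + 1 fractional parts fall into N boxes of width 1/N. *)
Lemma dirichlet_approx (R : realType) (theta : R) (N : nat) : (0 < N)%N ->
  exists (k : nat) (p : int), (0 < k <= N)%N /\ `|k%:R * theta - p%:~R| * N%:R < 1.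
Proof.
case: N => // N _.
pose fr (i : nat) : R := i%:R * theta - (Num.floor (i%:R * theta))%:~R.
have fr01 i : 0 <= fr i < 1.
  have := floor_itv (i%:R * theta : R); rewrite /fr rmorphD /= => /andP[h1 h2].
  by rewrite subr_ge0 h1 /= ltrBlDl.
pose F (i : 'I_N.+2) : 'I_N.+1 := inord `|Num.floor (N.+1%:R * fr i)|.
have N0 : (0 : R) < N.+1%:R by rewrite ltr0n.
have FE i : ((F i : nat)%:R : R) <= N.+1%:R * fr i < (F i : nat)%:R + 1.
  have /andP[f0 f1] := fr01 i.
  have P0 : 0 <= N.+1%:R * fr i by rewrite mulr_ge0 // ltW.
  have P1 : N.+1%:R * fr i < N.+1%:R by rewrite gtr_pMr.
  have fl0 : 0 <= Num.floor (N.+1%:R * fr i) by rewrite floor_ge0.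
  have := floor_itv (N.+1%:R * fr i : R).
  rewrite rmorphD /= -(gez0_abs fl0) /F inordK //.
  rewrite -ltz_nat gez0_abs // -(ltr_int R) (le_lt_trans (floor_le _)) //.
have /injectivePn[i [j ij Fij]] : ~~ injectiveb F.
  by apply/injectiveP => /leq_card; rewrite !card_ord ltnn.
wlog lt_ij : i j ij Fij / (i < j)%N.
  move=> H; have := ij; rewrite -val_eqE neq_ltn => /orP[|] lt; first exact: (H i j).
  by apply: (H j i) => //; rewrite eq_sym.
exists (j - i)%N, (Num.floor (j%:R * theta) - Num.floor (i%:R * theta)).
split; first by rewrite subn_gt0 lt_ij /= leq_subLR (leq_trans (leq_ord j)) // leq_addl.
have -> : (j - i)%:R * theta - (Num.floor (j%:R * theta) - Num.floor (i%:R * theta))%:~R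
   = fr j - fr i.
  by rewrite natrB ?(ltnW lt_ij) // rmorphB /= /fr; ring.
rewrite -(gtr0_norm N0) -normrM ltr_norml.
by have := FE i; have := FE j; rewrite Fij => /andP[h1 h2] /andP[h3 h4]; lra.
Qed.

(** Dirichlet with N > 1/e gives k <= N and a distance below 1/N, so the product is below 1/N < e.
    The boolean form suits the choice of a least [k]. *)
Lemma exists_small_square (R : realType) (theta e : R) : 0 < e ->
  exists k : nat, (0 < k)%N && `[< exists p : int, k%:R * (k%:R * theta - p%:~R) ^+ 2 < e >].
Proof.
move=> e0; have ei : 0 <= e^-1 by rewrite invr_ge0 ltW.
have := archi_boundP ei; set N := Num.Def.archi_bound _ => eN.
have N0 : (0 < N)%N by rewrite -(ltr0n R); apply: le_lt_trans eN.
have [k [p [/andP[k0 kN] hk]]] := @dirichlet_approx R theta N N0.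
exists k; rewrite k0; apply/asboolP; exists p.
have N0' : (0 : R) < N%:R by rewrite ltr0n.
have h1 : 1 < e * N%:R by rewrite -ltr_pdivrMl ?mulr1.
have h2 : (`|k%:R * theta - p%:~R| * N%:R) ^+ 2 < 1 by rewrite expr_lt1 // mulr_ge0.
rewrite exprMn real_normK ?num_real // in h2.
set y := (_ - _) ^+ 2 in h2 *; have y0 : 0 <= y := sqr_ge0 _.
have kN' : (k%:R : R) <= N%:R by rewrite ler_nat.
have h3 : k%:R * (y * N%:R) <= N%:R * (y * N%:R).
  by rewrite ler_wpM2r // mulr_ge0 // ltW.
rewrite -(@ltr_pM2r _ N%:R) //; nra.
Qed.

Lemma irrational_mul_neq_int (R : realType) (theta : R) (k : nat) (p : int) :
  (forall q : rat, theta != ratr q) -> (0 < k)%N -> k%:R * theta != p%:~R.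
Proof.
move=> irr k0; apply/eqP => kp; have /eqP := irr (p%:~R / k%:R); apply.
rewrite rmorph_div /= ?unitfE ?pnatr_eq0 -?lt0n // ratr_int ratr_nat -kp mulrC mulKf //.
by rewrite pnatr_eq0 -lt0n.
Qed.

Lemma dist_int_gt0 (R : realType) (y : R) : (forall p : int, y != p%:~R) ->
  exists2 e : R, 0 < e & forall p : int, e <= (y - p%:~R) ^+ 2.
Proof.
move=> ny; have /andP[] := floor_itv y; rewrite le_eqVlt eq_sym (negbTE (ny _)) /=.
set a := Num.floor y; rewrite rmorphD /= => ay ya.
exists (Num.min ((y - a%:~R) ^+ 2) ((a%:~R + 1 - y) ^+ 2)) => [|p].
  by rewrite lt_min !exprn_gt0 ?subr_gt0.
rewrite ge_min; apply/orP; have [pa|ap] := leP p a; [left|right].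
  have : (p%:~R : R) <= a%:~R by rewrite ler_int.
  nra.
have : ((a + 1)%:~R : R) <= p%:~R by rewrite ler_int lezD1.
rewrite rmorphD /=; nra.
Qed.

(** A threshold below this [e] pushes the least admissible [k] beyond [M], which makes the shifts
    unbounded. *)
Lemma square_lower_bound (R : realType) (theta : R) (M : nat) :
  (forall q : rat, theta != ratr q) ->
  exists2 e : R, 0 < e & forall (k : nat) (p : int), (0 < k <= M)%N ->
    e <= k%:R * (k%:R * theta - p%:~R) ^+ 2.
Proof.
move=> irr; elim: M => [|M [e e0 IH]]; first by exists 1 => // -[].
have [e1 e10 H1] := @dist_int_gt0 R (M.+1%:R * theta)
  (fun p => irrational_mul_neq_int R theta M.+1 p irr isT).
exists (Num.min e e1) => [|k p /andP[k0]]; first by rewrite lt_min e0.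
rewrite leq_eqVlt ltnS ge_min => /orP[/eqP->|kM]; last by rewrite IH ?k0.
by rewrite (le_trans (H1 p)) ?orbT // ler_peMl ?sqr_ge0 // ler1n.
Qed.

Lemma exists_good_shift (R : realType) (theta : R) (s M : nat) :
  (forall q : rat, theta != ratr q) -> (1 < s)%N ->
  exists rp : nat * int, let eps := rp.1%:R * theta - rp.2%:~R in
  [/\ (M < rp.1)%N, eps != 0, s%:R * `|eps| < 1 &
  forall (k : nat) (q : int), (0 < k)%N -> (s ^ 2 * k <= rp.1)%N ->
    s%:R * `|eps| <= `|k%:R * theta - q%:~R|].
Proof.
move=> irr s1; have s0 : (0 : R) < s%:R by rewrite ltr0n ltnW.
have [e e0 he] := square_lower_bound R theta M irr.
(* The cap [e] forces [r > M]; the cap [s ^- 2], with [r >= 1], forces [s * |eps| < 1]. *)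
pose e' := Num.min e (s%:R ^- 2).
have e'0 : 0 < e' by rewrite lt_min e0 invr_gt0 exprn_gt0.
have [r /andP[r0 /asboolP[p hp]] rmin] := ex_minnP (exists_small_square R theta e' e'0).
exists (r, p) => /=; set eps := r%:R * theta - p%:~R in hp *.
have r1 : (1 : R) <= r%:R by rewrite ler1n.
have eps2 : 0 <= eps ^+ 2 := sqr_ge0 _.
have hp1 : r%:R * eps ^+ 2 < s%:R ^- 2.
  by apply: (lt_le_trans hp); rewrite ge_min lexx orbT.
have big k q : (0 < k)%N -> (k < r)%N -> e' <= k%:R * (k%:R * theta - q%:~R) ^+ 2.
  move=> k0 kr; rewrite leNgt; apply/negP => H.
  have := rmin k; rewrite k0 /= leqNgt kr => /(_ _)/notF; apply.
  by apply/asboolP; exists q.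
split.
- rewrite ltnNge; apply/negP => rM; have := he r p; rewrite r0 rM => /(_ isT).
  by rewrite leNgt (lt_le_trans hp) // ge_min lexx.
- by rewrite subr_eq0 irrational_mul_neq_int.
- have -> : s%:R * `|eps| = `|s%:R * eps| by rewrite normrM gtr0_norm.
  rewrite -(@expr_lt1 _ 2) // real_normK ?num_real // exprMn.
  rewrite -ltr_pdivlMl ?exprn_gt0 // mulr1; nra.
- move=> k q k0 sk; have -> : s%:R * `|eps| = `|s%:R * eps| by rewrite normrM gtr0_norm.
  (* Since [s > 1], minimality of [r] applies to [k]; then k y^2 >= e' > r eps^2 >= s^2 k eps^2. *)
  have kr : (k < r)%N by nia.
  have := big k q k0 kr; set y := k%:R * theta - _ => hy.
  rewrite -ler_sqr ?nnegrE // !real_normK ?num_real // exprMn.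
  have k0' : (0 : R) < k%:R by rewrite ltr0n.
  rewrite -(ler_pM2l k0') mulrA.
  have skR : k%:R * s%:R ^+ 2 <= r%:R :> R by rewrite -natrX -natrM ler_nat mulnC.
  nra.
Qed.

(** * Jumps of the floor function along a progression *)

(** The progression is monotone with total displacement below 1, so it crosses at most one integer,
    [t + 1]. Rising, it crosses by reaching the integer; falling, only by passing strictly below:
    hence the two half-open windows. *)
Lemma floor_progression (R : realType) (x eps : R) (s : nat) : s%:R * `|eps| < 1 ->
  (forall i : nat, (i <= s)%N -> Num.floor (x + i%:R * eps) = Num.floor x) \/
  exists (t : int) (j : nat) (b : bool), [/\ (0 < j <= s)%N,
    forall i : nat, (i <= s)%N ->
      Num.floor (x + i%:R * eps) = t + ((b (+) (j <= i)%N) : nat)%:R &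
    0 < (t + 1)%:~R - x <= s%:R * eps \/ 0 <= x - (t + 1)%:~R < - (s%:R * eps)].
Proof.
move=> h; pose P j := (j <= s)%N && (Num.floor (x + j%:R * eps) != Num.floor x).
have [exP|nP] := boolp.pselect (exists j, P j); last first.
  left=> i is_; apply/eqP; apply: contrapT => /negP ne.
  by apply: nP; exists i; rewrite /P is_.
right; have [j /andP[js jne] jmin] := ex_minnP exP.
have hlt i : (i < j)%N -> Num.floor (x + i%:R * eps) = Num.floor x.
  move=> ij; apply/eqP; apply/negPn/negP => ne; have := jmin i.
  by rewrite /P ne (leq_trans (ltnW ij) js) leqNgt ij => /(_ isT).
have j0 : (0 < j)%N by case: j jne {js jmin hlt} => //; rewrite mul0r addr0 eqxx.
have bnd i : (i <= s)%N -> `|i%:R * eps| <= s%:R * `|eps|.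
  by move=> is_; rewrite normrM ger0_norm // ler_wpM2r // ler_nat.
have /andP[f1 f2] := floor_itv x; rewrite rmorphD /= in f2.
have [e0|e0] := leP 0 eps.
- exists (Num.floor x), j, false; split=> [|i is_|]; first by rewrite j0.
  + have [ji|/hlt ->] := leqP j i; last by rewrite addr0.
    apply/eqP; rewrite eq_le; apply/andP; split.
      rewrite -ltzD1 -(ltr_int R) (le_lt_trans (floor_le _)) //.
      have := bnd i is_; rewrite ler_norml => /andP[_]; rewrite !rmorphD /=; lra.
    rewrite lezD1; apply: (@lt_le_trans _ _ (Num.floor (x + j%:R * eps))).
      by rewrite lt_neqAle eq_sym jne le_floor // lerDl mulr_ge0.
    by rewrite le_floor // lerD2l ler_wpM2r // ler_nat.
  left; have : Num.floor x + 1 <= Num.floor (x + j%:R * eps).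
    by rewrite lezD1 lt_neqAle eq_sym jne le_floor // lerDl mulr_ge0.
  rewrite floor_ge_int => H; rewrite rmorphD /= in H *.
  have : j%:R * eps <= s%:R * eps by rewrite ler_wpM2r // ler_nat.
  by move=> H2; apply/andP; split; lra.
(* On a falling progression the indices before the crossing carry the larger value, so [t] is the
   value after it. *)
- exists (Num.floor x - 1), j, true; split=> [|i is_|]; first by rewrite j0.
  + have [ji|/hlt ->] := leqP j i; last by rewrite subrK.
    rewrite addr0; apply/eqP; rewrite eq_le; apply/andP; split.
      rewrite -ltzD1 subrK; apply: (@le_lt_trans _ _ (Num.floor (x + j%:R * eps))).
        by rewrite le_floor // lerD2l ler_wnM2r ?ler_nat // ltW.
      by rewrite lt_neqAle jne le_floor // gerDl mulr_ge0_le0 // ltW.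
    rewrite floor_ge_int rmorphB /=.
    have := bnd i is_; rewrite ler_norml => /andP[]; lra.
  right; rewrite subrK; have : Num.floor (x + j%:R * eps) < Num.floor x.
    by rewrite lt_neqAle jne le_floor // gerDl mulr_ge0_le0 // ltW.
  rewrite ltNge floor_ge_int -ltNge => H.
  have : s%:R * eps <= j%:R * eps by rewrite ler_wnM2r ?ler_nat // ltW.
  by move=> H2; apply/andP; split; lra.
Qed.

(** Removing the integer part [i * p] leaves a progression of step [eps]. The flat case also records
    the floor at i = 1, which the infinitude argument needs. *)
Lemma window_sum (R : realType) (theta alpha : R) (f : {poly int}) (r : nat) (p : int)
    (m : nat) :
  let s := size f in let eps := r%:R * theta - p%:~R in let x := m%:R * theta + alpha in
  let w := \sum_(i < s.+1)
    altbin s i * f.[Num.floor ((m + i * r)%N%:R * theta + alpha)] in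
  (0 < s)%N -> s%:R * `|eps| < 1 ->
  (w = 0 /\ Num.floor ((m + r)%N%:R * theta + alpha) = Num.floor x + p) \/
  exists (t : int) (c : nat -> bool), [/\
    w = \sum_(i < s.+1) altbin s i * f.[t + i%:R * p + (c i : nat)%:R],
    \sum_(i < s.+1) altbin s i * (c i : nat)%:R != 0,
    `|x - (t + 1)%:~R| < 1 &
    0 < (t + 1)%:~R - x <= s%:R * eps \/ 0 <= x - (t + 1)%:~R < - (s%:R * eps)].
Proof.
move=> s eps x w s0 heps.
have flE (i : nat) : Num.floor ((m + i * r)%N%:R * theta + alpha) =
    Num.floor (x + i%:R * eps) + i%:R * p.
  have -> : (m + i * r)%N%:R * theta + alpha = x + i%:R * eps + (i%:R * p)%:~R.
    by rewrite rmorphM /= mulrz_nat natrD natrM /x /eps; ring.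
  by rewrite floorDrz ?intr_int // intrKfloor.
have [flat|[t [j [b [js jump win]]]]] := floor_progression R x eps s heps; [left|right].
  split; last by rewrite -(flat 1%N s0) -[r in LHS]mul1n flE !mul1r.
  rewrite -(altbin_sum_poly s f (Num.floor x) p (leqnn _)).
  apply: eq_bigr => i _; rewrite flE flat //; first by rewrite -ltnS.
exists t, (fun i => b (+) (j <= i)%N); split=> //.
- apply: eq_bigr => i _; rewrite flE jump; last by rewrite -ltnS.
  by rewrite addrAC.
- exact: altbin_sum_step.
- have : `|s%:R * eps| < 1 by rewrite normrM ger0_norm.
  by rewrite !ltr_norml => /andP[h1 h2]; case: win => /andP[h3 h4]; apply/andP; split; lra.
Qed.

(** The sign of [d] puts both offsets in the same half-open interval of length [|d|], so their
    difference is strictly smaller. *)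
Lemma window_distance (R : realType) (x x' : R) (z z' : int) (d : R) :
  (0 < z%:~R - x <= d \/ 0 <= x - z%:~R < - d) ->
  (0 < z'%:~R - x' <= d \/ 0 <= x' - z'%:~R < - d) ->
  `|x' - x - (z' - z)%:~R| < `|d|.
Proof.
rewrite rmorphB /= ltr_norml.
have := ler_norm d; have := ler_norm (- d); rewrite normrN => n1 n2.
by case=> /andP[h1 h2]; case=> /andP[h3 h4]; apply/andP; split; lra.
Qed.

(** Iterating along [M + i * r] would give [i * |eps| < 1] for every [i], against the Archimedean
    property. *)
Lemma floor_shift_unstable (R : realType) (theta alpha eps : R) (r M : nat) (p : int) :
  eps = r%:R * theta - p%:~R -> eps != 0 ->
  ~ (forall m, (M <= m)%N ->
    Num.floor ((m + r)%N%:R * theta + alpha) = Num.floor (m%:R * theta + alpha) + p).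
Proof.
move=> epsE eps0 H.
have fl (i : nat) : Num.floor ((M + i * r)%N%:R * theta + alpha) =
    Num.floor (M%:R * theta + alpha) + i%:R * p.
  elim: i => [|i IH]; first by rewrite addn0 mul0r addr0.
  by rewrite mulSn addnCA addnC H ?leq_addr // IH -natr1; ring.
set x := M%:R * theta + alpha in fl.
have small (i : nat) : i%:R * `|eps| < 1.
  rewrite -[i%:R]ger0_norm // -normrM.
  have /andP[] := floor_itv ((M + i * r)%N%:R * theta + alpha); rewrite fl.
  have -> : (M + i * r)%N%:R * theta + alpha = x + i%:R * eps + i%:R * p%:~R.
    by rewrite natrD natrM /x epsE; ring.
  have /andP[] := floor_itv x; rewrite !rmorphD !rmorphM /= mulrz_nat ltr_norml.
  by move=> *; apply/andP; split; lra.
have e0 : 0 < `|eps| by rewrite normr_gt0.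
have ei : 0 <= `|eps|^-1 by rewrite invr_ge0.
have := archi_boundP ei; rewrite -[X in X < _]mul1r ltr_pdivrMr // => /lt_trans/(_ (small _)).
by rewrite ltxx.
Qed.

(** * Polynomial variation and verification of the condition *)

(** If [t >= K * r], then [t ^ D] is controlled by [v], and [t'] exceeds [t] by O(k). Otherwise
    [t < K * r <= K * q * k], so [t'] itself is O(k). Here [q] is the gap constant. *)
Lemma variation_bound (A K q k r t t' v v' : int) (D : nat) :
  1 <= A -> 2 <= K -> 1 <= q -> 1 <= k -> 1 <= r -> r <= q * k ->
  -1 <= t -> -1 <= t' -> t' <= t + k + 1 -> 0 <= v ->
  (forall N, r <= N -> `|t'| <= N -> v' <= A * N ^+ D) ->
  (K * r <= t -> t ^+ D <= 2 * v) ->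
  v' <= A * (2 ^+ D * 2 + (2 * (K + 4) * q) ^+ D) * (k ^+ D + v).
Proof.
move=> A1 K2 q1 k1 r1 rqk tm1 tm1' tt' v0 up lo.
have A0 : 0 <= A by lia.
have kqk : k <= q * k by rewrite ler_peMl //; lia.
have k0 : 0 <= k by lia.
have Kr : K * r <= K * (q * k) by rewrite ler_wpM2l //; lia.
have Kqk : 2 * (q * k) <= K * (q * k) by rewrite ler_wpM2r //; lia.
have Q0 : 0 <= (2 * (K + 4) * q) ^+ D by rewrite exprn_ge0 // !mulr_ge0 //; lia.
have P0 : 0 <= (2 : int) ^+ D * 2 by rewrite mulr_ge0 ?exprn_ge0.
apply: (@le_trans _ _ (A * (2 ^+ D * 2 * v + (2 * (K + 4) * (q * k)) ^+ D))); last first.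
  rewrite -[leRHS]mulrA ler_wpM2l // (mulrA _ q) exprMn.
  have h1 : 0 <= k ^+ D by rewrite exprn_ge0.
  have := mulr_ge0 P0 h1; have := mulr_ge0 Q0 v0; clear.
  move: (_ * 2) (_ ^+ D) (k ^+ D) => a b e; lia.
have [tK|tK] := leP (K * r) t.
  have t0 : 0 <= t by lia.
  apply: (le_trans (up (t + 4 * (q * k)) _ _)); [lia | lia |].
  rewrite ler_wpM2l //; apply: (le_trans (exprD_le _ _ _ t0 _)); first lia.
  rewrite exprMn lerD //; first by rewrite -mulrA ler_wpM2l ?exprn_ge0 // lo.
  by rewrite lerXn2r ?nnegrE //; lia.
apply: (le_trans (up ((K + 4) * (q * k)) _ _)); [lia | lia |].
rewrite ler_wpM2l // -[leLHS]add0r lerD ?mulr_ge0 // lerXn2r ?nnegrE //; lia.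
Qed.

Theorem mainTheorem2 (R : realType) (theta alpha : R) (f : {poly int}) :
  0 < theta < 1 -> 0 < alpha < 1 ->
  (forall q : rat, theta != ratr q) ->
  (1 < size f)%N ->
  condition_star R (fun m : nat => f.[Num.floor (m%:R * theta + alpha)]).
Proof.
move=> /andP[th0 th1] /andP[al0 _] irr sf.
have [D [A [K [A1 K2 est]]]] := jump_sum_estimate f sf.
set s := size f in est *.
have s0 : (0 < s)%N := ltnW sf.
have [rp good] := boolp.choice (fun n => exists_good_shift R theta s n irr sf).
pose eps n : R := (rp n).1%:R * theta - (rp n).2%:~R.
have epsn0 n : eps n != 0 by have [] := good n.
have epss n : s%:R * `|eps n| < 1 by have [] := good n.
have r0 n : (0 < (rp n).1)%N by have [nr _ _ _] := good n; apply: leq_ltn_trans nr.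
(* [p] is within 1 of [r * theta], which lies in [[0, r]]; integrality closes both ends. *)
have prange n : 0 <= (rp n).2 <= (rp n).1%:Z.
  have : `|eps n| < 1.
    by apply: le_lt_trans (epss n); rewrite ler_peMl // ler1n.
  rewrite ltr_norml /eps => /andP[h1 h2].
  have rth : 0 <= (rp n).1%:R * theta <= (rp n).1%:R.
    by rewrite mulr_ge0 ?(ltW th0) //= ler_piMr // ltW.
  move: rth => /andP[h3 h4]; apply/andP; split.
    rewrite -ltzD1 -(ltr_int R) !rmorphD /=; lra.
  rewrite -ltzD1 -(ltr_int R) !rmorphD /= -pmulrn; lra.
pose x m : R := m%:R * theta + alpha.
have x0 m : 0 <= x m by rewrite addr_ge0 ?mulr_ge0 // ltW.
pose b (i : 'I_s.+1) := altbin s i.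
pose r n := (rp n).1.
pose u (m : nat) := f.[Num.floor (m%:R * theta + alpha)].
pose W t (c : nat -> bool) n m := [/\ wseq u b r n m =
    \sum_(i < s.+1) altbin s i * f.[t + i%:R * (rp n).2 + (c i : nat)%:R],
    \sum_(i < s.+1) altbin s i * (c i : nat)%:R != 0,
    `|x m - (t + 1)%:~R| < 1 &
    0 < (t + 1)%:~R - x m <= s%:R * eps n \/ 0 <= x m - (t + 1)%:~R < - (s%:R * eps n)].
have win n m : (wseq u b r n m = 0 /\
    Num.floor ((m + r n)%N%:R * theta + alpha) = Num.floor (x m) + (rp n).2) \/
    exists t c, W t c n m.
  exact: (window_sum R theta alpha f (rp n).1 (rp n).2 m s0 (epss n)).
have inD n m : m \in Delta u b r n -> exists t c, W t c n m.
  by rewrite in_setE /Delta /= => nz; have [[/eqP]|//] := win n m; rewrite (negbTE nz).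
(* Two jumps put [(m' - m) * theta] closer than [s * |eps|] to the integer [t' - t], which the good
   shift forbids for small [m' - m]. *)
have gap n m m' : m \in Delta u b r n -> m' \in Delta u b r n -> (m < m')%N ->
    (r n < s ^ 2 * (m' - m))%N.
  move=> /inD[t [c [_ _ _ w1]]] /inD[t' [c' [_ _ _ w2]]] mm'; rewrite ltnNge; apply/negP => H.
  have [_ _ _ /(_ (m' - m)%N (t' - t))] := good n; rewrite subn_gt0 => /(_ mm' H).
  have := window_distance R _ _ _ _ _ w1 w2; rewrite -/(eps n).
  have -> : x m' - x m - (t' + 1 - (t + 1))%:~R = (m' - m)%N%:R * theta - (t' - t)%:~R.
    by rewrite natrB ?(ltnW mm') // /x !rmorphB !rmorphD /=; ring.
  by rewrite normrM ger0_norm // => h /le_lt_trans /(_ h); rewrite ltxx.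
exists s, b, r; split=> //; split; [|split; [|split]].
- by move=> M; exists M; have [] := good M.
- move=> n /finite_seqP[S DS].
  (* Past this bound [x m > K * r + 2]; the 2 absorbs the unit in [t + 1] and the distance below 1
     from [x m] to it, so a jump there has [t >= K * r]. *)
  have y0 : 0 <= ((K * (rp n).1%:Z + 2)%:~R : R) / theta.
    rewrite mulr_ge0 ?invr_ge0 ?(ltW th0) // ler0z addr_ge0 // mulr_ge0 //; lia.
  have := archi_boundP y0; set M1 := Num.Def.archi_bound _; rewrite ltr_pdivrMr // => hM1.
  apply: (@floor_shift_unstable R theta alpha (eps n) (rp n).1
    (maxn M1 (\max_(i <- S) i).+1) (rp n).2 erefl (epsn0 n)).
  move=> m; rewrite geq_max => /andP[mM1 mS].
  have wm0 : wseq u b r n m = 0.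
    apply/eqP/negPn/negP => nz; have : Delta u b r n m by [].
    rewrite DS /= => /(@leq_bigmax_seq _ S xpredT id m) /(_ isT).
    by rewrite leqNgt mS.
  have [[_ //]|[t [c [wE nz tx _]]]] := win n m.
  have Kt : K * (rp n).1%:Z <= t.
    have mm : M1%:R * theta <= m%:R * theta by rewrite ler_pM2r // ler_nat.
    rewrite -ltzD1 -(ltr_int R); move: tx hM1; rewrite ltr_norml /x !rmorphD /= => /andP[].
    lra.
  have r1 : 1 <= (rp n).1%:Z by rewrite lez_nat.
  (* A late jump would give [0 < t ^ D <= 2 * |w| = 0]. *)
  have [_ /(_ nz Kt)] := est t (rp n).2 (rp n).1%:Z c r1 (prange n).
  rewrite -wE wm0 normr0 mulr0 leNgt exprn_gt0 //; nia.
- exists (s%:R ^- 2); split; first by rewrite invr_gt0 exprn_gt0 // ltr0n.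
  have key n m m' : m \in Delta u b r n -> m' \in Delta u b r n -> (m < m')%N ->
      s%:R ^- 2 * (r n)%:R <= `|(m%:R : R) - m'%:R|.
    move=> h h' mm'; rewrite ler_pdivrMl ?exprn_gt0 ?ltr0n // distrC -natrB ?(ltnW mm') //.
    by rewrite ger0_norm // -natrX -natrM ler_nat ltnW // gap.
  move=> n m m' h h' /eqP; rewrite neq_ltn => /orP[lt|lt]; first exact: key.
  by rewrite distrC; apply: key.
(* The constant of [variation_bound] for the gap constant [q = s ^ 2]; the exponent [c0] is [D]. *)
- pose C : int := A * (2 ^+ D * 2 + (2 * (K + 4) * (s ^ 2)%:Z) ^+ D).
  have C0 : 0 < C.
    have Q0 : 0 <= (2 * (K + 4) * (s ^ 2)%:Z) ^+ D.
      by rewrite exprn_ge0 // !mulr_ge0 //; lia.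
    apply: mulr_gt0; first by apply: lt_le_trans A1.
    by apply: ltr_wpDr => //; rewrite mulr_gt0 ?exprn_gt0.
  exists D%:R, C%:~R; split=> //; split; first by rewrite ltr0z.
  move=> n m m' h h' mm'; have := gap n m m' h h' mm'.
  set k := (m' - m)%N => rk; rewrite powR_mulrn // -[k%:R]mulrz_nat -rmorphXn -rmorphD -rmorphM.
  rewrite ler_int.
  have [t [c [wE nz tx _]]] := inD n m h.
  have [t' [c' [w'E _ tx' _]]] := inD n m' h'.
  have r1 : 1 <= (rp n).1%:Z by rewrite lez_nat.
  have [_ /(_ nz)] := est t (rp n).2 (rp n).1%:Z c r1 (prange n); rewrite -wE.
  have [+ _] := est t' (rp n).2 (rp n).1%:Z c' r1 (prange n); rewrite -w'E.
  move: (wseq u b r n m) (wseq u b r n m') => w w' up lo.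
  set k' : int := k%:R; set q : int := (s ^ 2)%:Z.
  have k1 : 1 <= k' by rewrite ler1n subn_gt0.
  have q1 : 1 <= q by rewrite lez_nat expn_gt0 s0.
  have rqk : (rp n).1%:Z <= q * k' by rewrite /k' natz -PoszM lez_nat ltnW.
  have tm1 : -1 <= t.
    rewrite -ltzD1 -(ltr_int R); move: tx; rewrite ltr_norml !rmorphD /= => /andP[].
    have := x0 m; lra.
  have tm1' : -1 <= t'.
    rewrite -ltzD1 -(ltr_int R); move: tx'; rewrite ltr_norml !rmorphD /= => /andP[].
    have := x0 m'; lra.
  (* From [t' < x m'], [x m < t + 2] and [theta < 1] comes [t' - t < k + 2]. *)
  have tt' : t' <= t + k' + 1.
    rewrite -ltzD1 -(ltr_int R).
    have xx : x m' - x m <= k%:R.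
      by rewrite /x /k natrB ?(ltnW mm') //; have : 0 <= (m'%:R - m%:R : R); [
        rewrite subr_ge0 ler_nat ltnW | nra].
    move: tx tx'; rewrite !ltr_norml !rmorphD /= -!pmulrn => /andP[h1 h2] /andP[h3 h4]; lra.
  exact: (variation_bound A K q k' (rp n).1%:Z t t').
Qed.
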